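(* Let $b>0$, let $F$ be a cumulative distribution function on $\mathbb{R}$, and let $f$ be its characteristic function. (i) If $f(t)$ is analytic in the strip $-b<\operatorname{Im} t<0$, then for any $A>0$ and arbitrary $s\in(0,b)$ $$1-F(A)\le \frac{A}{\exp(sA)-sA-1}\int_0^s\bigl(f(-iu)+F(+0)-1\bigr)\,du.$$ (ii) If $f(t)$ is analytic in the strip $0<\operatorname{Im} t<b$, then for any $A>0$ and arbitrary $s\in(0,b)$ $$F(-A)\le \frac{A}{\exp(sA)-sA-1}\int_0^s\bigl(f(iu)-F(-0)\bigr)\,du.$$
   Context: The characteristic function of a distribution function $F$ is $f(t)=\int_{-\infty}^{\infty}e^{itx}\,dF(x)$, $t\in\mathbb{R}$. $F(+0)=\lim_{x\downarrow 0}F(x)$ and $F(-0)=\lim_{x\uparrow 0}F(x)$ denote the right and left limits of $F$ at $0$. That the characteristic function is analytic in the strip is understood as follows: the integral $\int_{-\infty}^{\infty}e^{itx}\,dF(x)$ converges absolutely for every complex $t$ in the strip, and the characteristic function is continued analytically to the strip by this integral, so that $f(t)=\int_{-\infty}^{\infty}e^{itx}\,dF(x)$ there as well. *)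

(* Defs.v *)
From HB Require Import structures.
From mathcomp Require Import all_boot all_order all_algebra.
From mathcomp Require Import all_classical all_reals all_analysis.
From mathcomp.real_closed Require Import complex.

Set Implicit Arguments.
Unset Strict Implicit.
Unset Printing Implicit Defensive.

Import Order.TTheory GRing.Theory Num.Theory.
Import numFieldNormedType.Exports.

Local Open Scope classical_set_scope.
Local Open Scope ring_scope.
Local Open Scope complex_scope.

(* Num also exports the names Re and Im. *)
Local Notation Re := complex.Re.
Local Notation Im := complex.Im.

Section ComplexAnalysis.
Context {R : realType}.

Definition cexp (z : R[i]) : R[i] :=
  (expR (Re z) * cos (Im z)) +i* (expR (Re z) * sin (Im z)).

Definition cintegral d (T : measurableType d) (mu : {measure set T -> \bar R})
    (D : set T) (g : T -> R[i]) : R[i] :=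
  Rintegral mu D (fun x => Re (g x)) +i* Rintegral mu D (fun x => Im (g x)).

End ComplexAnalysis.

(* The normalization at the jumps is left open: both the right-continuous      *)
(* F(x) = P(X <= x) and the left-continuous F(x) = P(X < x) are admitted.      *)
Definition is_cdf (R : realType) (F : R -> R) : Prop :=
  [/\ {homo F : x y / x <= y},
      F x @[x --> -oo] --> (0 : R),
      F x @[x --> +oo] --> (1 : R) &
      (forall x : R, F y @[y --> x^'+] --> F x) \/
      (forall x : R, F y @[y --> x^'-] --> F x)].

Record cdf_type (R : realType) :=
  CdfType { cdf_fun :> R -> R ; cdf_funP : is_cdf cdf_fun }.

(* The library's Lebesgue-Stieltjes measure asks for a right-continuous        *)
(* function; dF does not depend on the values of F at its jumps, so it is the  *)
(* measure of the right-continuous version x |-> F(x+0), which is F itself if  *)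
(* F is right-continuous.                                                      *)
Section Stieltjes.
Context {R : realType} (F : cdf_type R).

Definition right_version (x : R) : R := lim (F y @[y --> x^'+]).

Let ndF : {homo F : x y / x <= y}. Proof. by case: (cdf_funP F). Qed.

Let cvF x : F y @[y --> x^'+] --> right_version x.
Proof.
apply: nondecreasing_at_right_is_cvgr.
  by near=> y => u v _ _; exact: ndF.
near=> y; exists (F x) => _ [u /= + <-].
by rewrite in_itv/= => /andP[xu _]; exact/ndF/ltW.
Unshelve. all: by end_near. Qed.

Let ge_right_version x : F x <= right_version x.
Proof.
apply: limr_ge; first exact: cvF.
by near=> y; apply/ndF/ltW; near: y; exact: nbhs_right_gt.
Unshelve. all: by end_near. Qed.

Let le_right_version x y : x < y -> right_version x <= F y.
Proof.
move=> xy; apply: limr_le; first exact: cvF.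
by near=> z; apply/ndF; near: z; exact: nbhs_right_le.
Unshelve. all: by end_near. Qed.

Let right_version_nd : {homo right_version : x y / x <= y}.
Proof.
move=> x y; rewrite le_eqVlt => /predU1P[->//|xy].
exact: le_trans (le_right_version xy) (ge_right_version y).
Qed.

Let right_version_rc x : right_version y @[y --> x^'+] --> right_version x.
Proof.
apply/cvgrPdist_le => e e0.
have /cvgrPdist_le/(_ e e0)[d /= d0 xd] := @cvF x.
near=> y.
have xy : x < y by near: y; exact: nbhs_right_gt.
rewrite distrC ger0_norm ?subr_ge0; last exact/right_version_nd/ltW.
pose z := (y + (x + d)) / 2.
have yd : y < x + d by near: y; apply: nbhs_right_lt; rewrite ltrDl.
have [yz zd] := midf_lt yd.
have xz := lt_trans xy yz.
apply: (@le_trans _ _ (F z - right_version x)).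
  by rewrite lerB// le_right_version.
rewrite (le_trans (ler_norm _))// distrC; apply: xd => //=.
by rewrite ltr0_norm ?subr_lt0// opprB ltrBlDl.
Unshelve. all: by end_near. Qed.

Let right_version_Ny : right_version @ -oo --> (0 : R).
Proof.
have [_ FNy _ _] := cdf_funP F.
apply: (@squeeze_cvgr _ _ _ _ F (fun x => F (x + 1))) => //.
  near=> x; rewrite ge_right_version le_right_version//.
  by rewrite ltrDl.
apply: (cvg_comp _ _ _ FNy) => A [M [Mr MA]].
exists (M - 1); split; first by rewrite num_real.
by move=> x; rewrite ltrBrDr => /MA.
Unshelve. all: by end_near. Qed.

Let right_version_y : right_version @ +oo --> (1 : R).
Proof.
have [_ _ Fy _] := cdf_funP F.
apply: (@squeeze_cvgr _ _ _ _ F (fun x => F (x + 1))) => //.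
  near=> x; rewrite ge_right_version le_right_version//.
  by rewrite ltrDl.
apply: (cvg_comp _ _ _ Fy) => A [M [Mr MA]].
exists (M - 1); split; first by rewrite num_real.
by move=> x; rewrite ltrBlDr => /MA.
Unshelve. all: by end_near. Qed.

HB.instance Definition _ :=
  isCumulative.Build R _ R right_version right_version_nd right_version_rc.

HB.instance Definition _ :=
  isCumulativeBounded.Build R 0 1 right_version
    right_version_Ny right_version_y.

Definition stieltjes : probability (measurableTypeR R) R :=
  lebesgue_stieltjes_measure right_version.

End Stieltjes.

Section CharacteristicFunction.
Context {R : realType} (F : cdf_type R).

Definition charf (t : R[i]) : R[i] :=
  cintegral (stieltjes F) setT (fun x : R => cexp ('i * t * x%:C)).

Definition charf_cvg_abs (t : R[i]) : Prop :=
  (\int[stieltjes F]_x (Re `|cexp ('i * t * (x : R)%:C)|)%:E < +oo)%E.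

(* Absolute convergence already implies the last two conditions; they express  *)
(* that the integral is the analytic continuation of the characteristic        *)
(* function from the real line to the strip. Derivability is complex: R[i] is  *)
(* a normed module over itself.                                                *)
Definition charf_analytic_in_strip (a b : R) : Prop :=
  let strip : set R[i]^o := [set t : R[i]^o | a < Im t < b] in
  [/\ forall t, strip t -> charf_cvg_abs t,
      forall t, strip t -> derivable (charf : R[i]^o -> R[i]^o) t 1 &
      {within (strip `|` [set t : R[i]^o | Im t = 0]),
         continuous (charf : R[i]^o -> R[i]^o)}].

End CharacteristicFunction.

(* Main.v *)
(* With X = x in (i) and X = - x in (ii), e^(uX) - 1_{X > 0} is at least       *)
(* (e^(uA) - 1) 1_{X >= A} for every u >= 0. Taking expectations bounds below  *)
(* the integrand of the theorem by (e^(uA) - 1) P(X >= A), and integrating     *)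
(* over u in [0, s] produces the factor (e^(sA) - sA - 1) / A.                 *)

Require Import Defs.
From mathcomp Require Import all_boot all_order all_algebra.
From mathcomp Require Import all_classical all_reals all_analysis.
From mathcomp Require Import measurable_realfun ring lra.
From mathcomp.real_closed Require Import complex.

Import Order.TTheory GRing.Theory Num.Theory.
Import numFieldNormedType.Exports.

Local Open Scope classical_set_scope.
Local Open Scope ring_scope.
Local Open Scope complex_scope.

(** On the imaginary axis the characteristic function is a moment generating function: for [t = -iu]
    or [t = iu] it equals M(u) = E e^(uX), with X = x or X = -x under dF. Absolute convergence at u
    = s makes M finite and bounded on [0, s], because e^(uX) <= 1 + e^(sX) there ([expRM_le]). The
    core is a Chernoff-type estimate, [expR_tail_moment]: subtracting P(X > 0), not 1, from M(u)
    still leaves at least (e^(uA) - 1) P(X >= A). Instead of fixing one exponent,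
    [tail_le_Rintegral_moment] averages over u in [0, s], where e^(uA) - 1 has an explicit integral.
    It remains to compare P(X > 0) and P(X >= A) with F and its one-sided limits ([stieltjes_gt],
    [stieltjes_ge], [stieltjes_lt], [stieltjes_le]); [charf_tail] then yields both halves, with a
    sign [e] equal to 1 or -1. *)

(** * Exponential moments and the averaged tail bound *)

Section Moment.
Context d {T : measurableType d} {R : realType} (P : probability T R).
Variables (X : T -> R) (s : R).
Hypotheses (mX : measurable_fun setT X) (s_gt0 : 0 < s).
Hypothesis fin_s : (\int[P]_x (expR (s * X x))%:E < +oo)%E.

Let M u := \int[P]_x expR (u * X x).

Lemma measurable_expRM (u : R) : measurable_fun setT (fun x => expR (u * X x)).
Proof. by apply: measurableT_comp => //; exact: measurable_funM. Qed.

(** Where X is nonnegative the second summand dominates, elsewhere the first. The bound does not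
    depend on [u], so it dominates the whole family at once. *)
Lemma expRM_le (u : R) x : 0 <= u <= s -> expR (u * X x) <= 1 + expR (s * X x).
Proof.
move=> /andP[u0 us]; have [X0|X0] := leP 0 (X x).
  by rewrite (@le_trans _ _ (expR (s * X x)))// ?ler_expR ?ler_wpM2r// lerDr.
by rewrite (@le_trans _ _ 1)// ?lerDl ?expR_ge0// -expR0 ler_expR mulr_ge0_le0// ltW.
Qed.

Lemma integrable_expRM (u : R) : 0 <= u <= s ->
  P.-integrable setT (fun x => (expR (u * X x))%:E).
Proof.
move=> us.
have ints : P.-integrable setT (fun x => (expR (s * X x))%:E).
  apply/integrableP; split; first by apply/measurable_EFinP; exact: measurable_expRM.
  by under eq_integral do rewrite gee0_abs ?lee_fin ?expR_ge0//.
have int1 : P.-integrable setT (fun x : T => (1 : R)%:E).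
  exact: finite_measure_integrable_cst.
apply: (le_integrable measurableT _ _ (integrableD measurableT int1 ints)).
  by apply/measurable_EFinP; exact: measurable_expRM.
move=> x _; rewrite -EFinD !abse_EFin lee_fin.
rewrite !ger0_norm ?addr_ge0 ?expR_ge0//.
exact: expRM_le.
Qed.

(** Tonelli: [M] integrates out one variable of a nonnegative, jointly measurable function of the
    pair. *)
Lemma measurable_moment : measurable_fun setT M.
Proof.
apply: (measurableT_comp (@fine_measurable R setT measurableT)).
have := @measurable_fun_fubini_tonelli_F _ _ (measurableTypeR R) T R P
  (fun z => (expR (z.1 * X z.2))%:E).
apply; last by move=> z; rewrite lee_fin expR_ge0.
apply/measurable_EFinP/measurableT_comp => //; apply: measurable_funM => //.
exact: measurableT_comp.
Qed.

Lemma integrable_moment : lebesgue_measure.-integrable `[0, s] (EFin \o M).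
Proof.
apply: measurable_bounded_integrable => //=.
- by rewrite lebesgue_measure_itv /= lte_fin s_gt0 ltry.
- exact: measurable_funTS measurable_moment.
(* This bound is [expRM_le] integrated against [P], which has total mass 1. *)
- exists (1 + M s); split; first exact: num_real.
  move=> y hy u; rewrite /= in_itv /= => /[dup] us /andP[u0 u1].
  rewrite ger0_norm; last by apply: Rintegral_ge0 => x _; exact: expR_ge0.
  apply: le_trans (ltW hy).
  have int1 : P.-integrable setT (EFin \o cst (1 : R)).
    exact: finite_measure_integrable_cst.
  have ints : P.-integrable setT (fun x => (expR (s * X x))%:E).
    by apply: integrable_expRM; rewrite lexx ltW.
  have -> : 1 = \int[P]_x (1 : R).
    by rewrite Rintegral_cst// mul1r [X in fine X](probability_setT P).
  rewrite -RintegralD//.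
  apply: le_Rintegral => //; first exact: integrable_expRM.
    exact: (integrableD measurableT int1 ints).
  by move=> x _; exact: expRM_le.
Qed.

Lemma measurable_superlevel (D : interval R) : measurable (X @^-1` [set` D]).
Proof. by rewrite -[X in measurable X]setTI; exact: mX. Qed.

Lemma Rintegral_indicT (D : set T) : measurable D ->
  \int[P]_x \1_D x = fine (P D).
Proof. by move=> mD; rewrite /Rintegral integral_indic// setIT. Qed.

Lemma expR_tail_moment (u A : R) : 0 < A -> 0 <= u <= s ->
  (expR (u * A) - 1) * fine (P [set x | A <= X x]) <=
  M u - fine (P [set x | 0 < X x]).
Proof.
move=> A0 us; have u0 : 0 <= u by case/andP: us.
have mA : measurable [set x | A <= X x].
  by rewrite -[X in measurable X]preimage_itvcy; exact: measurable_superlevel.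
have m0 : measurable [set x | 0 < X x].
  by rewrite -[X in measurable X]preimage_itvoy; exact: measurable_superlevel.
have iA := integrable_indic P mA; have i0 := integrable_indic P m0.
have iu := integrable_expRM _ us.
rewrite -!Rintegral_indicT// -RintegralZl// /M -RintegralB//.
apply: le_Rintegral => //.
- exact: (integrableZl measurableT (expR (u * A) - 1) iA).
- exact: (integrableB measurableT iu i0).
(* Pointwise cases: if X >= A both indicators are 1 and e^(uX) >= e^(uA); if 0 < X < A the claim is
   e^(uX) >= 1; if X <= 0 it is e^(uX) >= 0. *)
move=> x _; rewrite !indicE.
have [Ax|Ax] := boolP (x \in [set x | A <= X x]).
  move: Ax; rewrite inE/= => Ax; rewrite mem_set/=; last exact: lt_le_trans Ax.
  by rewrite mulr1 lerB// ler_expR ler_wpM2l.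
rewrite mulr0; have [|_] := boolP (x \in [set x | 0 < X x]).
  by rewrite inE/= => X0; rewrite subr_ge0 -expR0 ler_expR mulr_ge0// ltW.
by rewrite subr0 expR_ge0.
Qed.

Lemma continuous_expRM_sub1 (A : R) : continuous (fun u : R => expR (u * A) - 1).
Proof.
move=> u; apply: cvgB; last exact: cvg_cst.
apply: (@cvg_comp _ _ _ (fun v => v * A) expR _ (nbhs (u * A))).
  exact: mulrr_continuous.
exact: continuous_expR.
Qed.

Lemma Rintegral_expRM_sub1 (A : R) : 0 < A ->
  \int[lebesgue_measure]_(u in `[0, s]) (expR (u * A) - 1) =
  (expR (s * A) - s * A - 1) / A.
Proof.
move=> A0.
(* An antiderivative of e^(uA) - 1, to be evaluated between 0 and [s]. *)
pose G u : R := expR (u * A) / A - u.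
have dG (u : R) : is_derive u (1 : R) G (expR (u * A) - 1).
  apply: is_derive_eq.
  by rewrite /GRing.scale/=; field; rewrite gt_eqF.
have cG (u : R) : {for u, continuous G}.
  apply: differentiable_continuous; apply/derivable1_diffP; exact: ex_derive.
rewrite /Rintegral (@continuous_FTC2 _ _ G)//=.
- by rewrite /G mul0r expR0; field; rewrite gt_eqF.
- exact/continuous_subspaceT/continuous_expRM_sub1.
- split.
  + by move=> x _; exact: ex_derive.
  + exact: cvg_at_right_filter (cG 0).
  + exact: cvg_at_left_filter (cG s).
- by move=> x _; rewrite derive1E derive_val.
Qed.

Lemma tail_le_Rintegral_moment (A c : R) : 0 < A ->
  c <= fine (P [set x | 0 < X x]) ->
  fine (P [set x | A <= X x]) <= A / (expR (s * A) - s * A - 1) *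
    \int[lebesgue_measure]_(u in `[0, s]) (M u - c).
Proof.
move=> A0 cP.
have E0 : 0 < expR (s * A) - s * A - 1.
  by rewrite -addrA -opprD subr_gt0 addrC expR_gt1Dx// gt_eqF// mulr_gt0.
set p := fine _.
(* Moved to the left, the prefactor becomes the integral of e^(uA) - 1, so the claim reduces to
   comparing two integrands on [0, s]. *)
rewrite -ler_pdivrMl ?divr_gt0// invf_div mulrC [leLHS]mulrC -Rintegral_expRM_sub1//.
have cf : lebesgue_measure.-integrable `[0, s] (fun u => (expR (u * A) - 1)%:E).
  apply: continuous_compact_integrable; first exact: segment_compact.
  exact/continuous_subspaceT/continuous_expRM_sub1.
have ic : lebesgue_measure.-integrable `[0, s] (EFin \o cst c).
  apply: continuous_compact_integrable; first exact: segment_compact.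
  by apply: continuous_subspaceT => x; exact: cvg_cst.
rewrite -RintegralZr//; apply: le_Rintegral => //.
- exact: (integrableZr _ p cf).
- exact: (integrableB _ integrable_moment ic).
move=> u; rewrite /= in_itv/= => us.
by rewrite (le_trans (expR_tail_moment _ _ A0 us))// lerB.
Qed.

End Moment.

(** * Masses of half-lines under dF against F and its one-sided limits *)

Section Stieltjes.
Context {R : realType} (F : cdf_type R).

Lemma cdf_homo : {homo F : x y / x <= y}.
Proof. by case: (cdf_funP F). Qed.

Lemma cvg_right_version x : F y @[y --> x^'+] --> right_version F x.
Proof.
apply: nondecreasing_at_right_is_cvgr.
  by near=> y => u v _ _; exact: cdf_homo.
near=> y; exists (F x) => _ [u /= + <-].
by rewrite in_itv/= => /andP[xu _]; exact/cdf_homo/ltW.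
Unshelve. all: by end_near. Qed.

Lemma le_right_version x : F x <= right_version F x.
Proof.
apply: limr_ge; first exact: cvg_right_version.
by near=> y; apply/cdf_homo/ltW; near: y; exact: nbhs_right_gt.
Unshelve. all: by end_near. Qed.

Lemma right_version_le x y : x < y -> right_version F x <= F y.
Proof.
move=> xy; apply: limr_le; first exact: cvg_right_version.
by near=> z; apply/cdf_homo; near: z; exact: nbhs_right_le.
Unshelve. all: by end_near. Qed.

Lemma stieltjes_itvNyc x : stieltjes F `]-oo, x]%classic = (right_version F x)%:E.
Proof. exact: cdf_lebesgue_stieltjes_id (right_version F) x. Qed.

(** Continuity from below: the open half-line is the increasing union of the closed ones ending at x
    - 1/(n+1), and each of these has mass F(x - 1/(n+1) + 0) <= F(x) by monotonicity. *)
Lemma stieltjes_itvNyo_le x : (stieltjes F `]-oo, x[%classic <= (F x)%:E)%E.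
Proof.
pose G n := `]-oo, x - n.+1%:R^-1]%classic : set (measurableTypeR R).
have UG : `]-oo, x[%classic = \bigcup_n G n.
  apply/seteqP; split=> [y|y [n _]]; rewrite /G/= !in_itv/=; last first.
    by move=> /le_lt_trans; apply; rewrite ltrBlDr ltrDl.
  rewrite -subr_gt0 => xy.
  (* For this n, 1/(x - y) < n + 1, hence y <= x - 1/(n+1). *)
  exists (Num.truncn (x - y)^-1) => //; rewrite /= in_itv/= lerBrDl -lerBrDr.
  by rewrite invf_ple ?posrE// ltW// truncnS_gt.
have mG n : measurable (G n) by exact: measurable_itv.
have ndG : nondecreasing_seq G.
  move=> m n mn; apply/subsetPset => y; rewrite /G/= !in_itv/= => /le_trans; apply.
  by rewrite lerB// lef_pV2 ?posrE// ler_nat.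
have /cvg_lim <- // : stieltjes F (G n) @[n --> \oo] -->
    stieltjes F `]-oo, x[%classic.
  by rewrite UG; apply: nondecreasing_cvg_mu => //; exact: bigcup_measurable.
apply: lime_le.
  apply: ereal_nondecreasing_is_cvgn => m n mn.
  by rewrite le_measure ?inE//; exact/subsetPset/ndG.
near=> n; rewrite [leLHS]stieltjes_itvNyc lee_fin right_version_le//.
by rewrite ltrBlDr ltrDl.
Unshelve. all: by end_near. Qed.

(** For y < x, F(y) <= F(y+0), which is the mass of the closed half-line ending at y, contained in
    the open one ending at x; then y tends to x. *)
Lemma lim_left_le x :
  ((lim (F y @[y --> x^'-]))%:E <= stieltjes F `]-oo, x[%classic)%E.
Proof.
rewrite -(@fineK _ (stieltjes F _)) ?fin_num_measure// lee_fin.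
apply: limr_le.
  apply: nondecreasing_at_left_is_cvgr.
    by near=> y => u v _ _; exact: cdf_homo.
  near=> y; exists (F x) => _ [u /= + <-].
  by rewrite in_itv/= => /andP[_ xu]; exact/cdf_homo/ltW.
near=> y.
rewrite -lee_fin fineK ?fin_num_measure//.
rewrite (@le_trans _ _ (right_version F y)%:E) ?lee_fin ?le_right_version//.
rewrite -stieltjes_itvNyc le_measure ?inE//.
by apply: subset_itvl; rewrite bnd_simp; near: y; exact: nbhs_left_lt.
Unshelve. all: by end_near. Qed.

Lemma stieltjes_le x : F x <= fine (stieltjes F [set y | y <= x]).
Proof. by rewrite -set_itvNyc stieltjes_itvNyc le_right_version. Qed.

Lemma stieltjes_lt x :
  lim (F y @[y --> x^'-]) <= fine (stieltjes F [set y | y < x]).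
Proof.
by rewrite -set_itvNyo -lee_fin fineK ?fin_num_measure ?lim_left_le.
Qed.

Lemma stieltjes_gt x :
  fine (stieltjes F [set y | x < y]) = 1 - lim (F y @[y --> x^'+]).
Proof.
rewrite -set_itvoy -setCitvl probability_setC; last exact: measurable_itv.
by rewrite stieltjes_itvNyc.
Qed.

Lemma stieltjes_ge x : 1 - F x <= fine (stieltjes F [set y | x <= y]).
Proof.
rewrite -set_itvcy -setCitvl probability_setC; last exact: measurable_itv.
rewrite fineB ?fin_num_measure//= lerB// -lee_fin fineK ?fin_num_measure//.
exact: stieltjes_itvNyo_le.
Qed.

End Stieltjes.

(** * The characteristic function on the imaginary axis *)

Section Charf.
Context {R : realType} (F : cdf_type R).

Lemma cexp_real (r : R) : cexp r%:C = (expR r)%:C.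
Proof. by rewrite /cexp /= cos0 sin0 mulr1 mulr0. Qed.

Lemma cintegral_real d (T : measurableType d) (mu : {measure set T -> \bar R})
    (D : set T) (g : T -> R[i]) (h : T -> R) :
  measurable D -> (forall x, g x = (h x)%:C) ->
  cintegral mu D g = (\int[mu]_(x in D) h x)%:C.
Proof.
move=> mD gh; rewrite /cintegral.
under eq_Rintegral do rewrite gh.
under [X in _ +i* X]eq_Rintegral do rewrite gh.
by rewrite Rintegral_cst// mul0r.
Qed.

Lemma charf_real t (r : R) : 'i * t = r%:C ->
  charf F t = (\int[stieltjes F]_x expR (r * x))%:C.
Proof.
move=> tr; apply: cintegral_real => // x.
by rewrite tr -rmorphM cexp_real.
Qed.

Lemma charf_cvg_abs_real t (r : R) : 'i * t = r%:C ->
  charf_cvg_abs F t -> (\int[stieltjes F]_x (expR (r * x))%:E < +oo)%E.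
Proof.
move=> tr; rewrite /charf_cvg_abs.
under eq_integral do
  rewrite tr -rmorphM cexp_real normc_def/=
    expr0n addr0 sqrtr_sqr ger0_norm ?expR_ge0//.
by [].
Qed.

(** Common form of both halves, applied with X = ex: [e = 1] goes with t(u) = -iu and [e = -1] with
    t(u) = iu. The inequality in [R[i]] reduces to a real one since both sides have imaginary part
    0. *)
Lemma charf_tail (t : R -> R[i]) (e A s p c : R) :
  (forall u, 'i * t u = (u * e)%:C) -> charf_cvg_abs F (t s) ->
  0 < A -> 0 < s ->
  c <= fine (stieltjes F [set x | 0 < e * x]) ->
  p <= fine (stieltjes F [set x | A <= e * x]) ->
  p%:C <= (A / (expR (s * A) - s * A - 1))%:C *
    cintegral lebesgue_measure `[0, s] (fun u : R => charf F (t u) - c%:C).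
Proof.
move=> tE cvF A0 s0 c_le p_le.
rewrite (@cintegral_real _ (measurableTypeR R) lebesgue_measure _ _
  (fun u : R => \int[stieltjes F]_x expR (u * (e * x)) - c))//; last first.
  move=> u; rewrite (charf_real _ _ (tE u)) -rmorphB/=; congr (_ - _)%:C.
  by apply: eq_Rintegral => x _; rewrite mulrA.
rewrite -rmorphM/= lecR; apply: le_trans p_le _.
apply: tail_le_Rintegral_moment => //.
under eq_integral do rewrite mulrA.
exact: charf_cvg_abs_real (tE s) cvF.
Qed.

End Charf.

Theorem theorem3p1 (R : realType) (b : R) (b_gt0 : 0 < b) (F : cdf_type R) :
  (charf_analytic_in_strip F (- b) 0 ->
   forall A s : R, 0 < A -> 0 < s < b ->
     (1 - F A)%:C <=
       (A / (expR (s * A) - s * A - 1))%:C *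
       cintegral lebesgue_measure `[0, s]
         (fun u : R => charf F (- 'i * u%:C)
                       + (lim (F x @[x --> 0^'+]))%:C - 1))
  /\
  (charf_analytic_in_strip F 0 b ->
   forall A s : R, 0 < A -> 0 < s < b ->
     (F (- A))%:C <=
       (A / (expR (s * A) - s * A - 1))%:C *
       cintegral lebesgue_measure `[0, s]
         (fun u : R => charf F ('i * u%:C)
                       - (lim (F x @[x --> 0^'-]))%:C)).
Proof.
split=> -[cvF _ _] A s A0 /andP[s0 sb].
(* The integrand is regrouped as f(-iu) - c with c = 1 - F(+0), which is exactly the mass of the
   positive half-line. *)
- under [X in cintegral _ _ X]eq_fun do rewrite -addrA -opprB -[1%R]/(1%:C) -rmorphB.
  apply: (charf_tail _ _ 1) => //.
  + by move=> u; rewrite mulrA mulrN -expr2 sqr_i opprK mul1r mulr1.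
  + by apply: cvF => /=; lra.
  + by under eq_set do rewrite mul1r; rewrite stieltjes_gt.
  + by under eq_set do rewrite mul1r; exact: stieltjes_ge.
- apply: (charf_tail _ _ (- 1)) => //.
  + by move=> u; rewrite mulrA -expr2 sqr_i mulrN1 mulN1r rmorphN.
  + by apply: cvF => /=; lra.
  + by under eq_set do rewrite mulN1r oppr_gt0; exact: stieltjes_lt.
  + by under eq_set do rewrite mulN1r lerNr; exact: stieltjes_le.
Qed.
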